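(* Let $\beta>0$, let $x=(x_n)_{n\ge1}$ be any real sequence with $x_1>0$ (not necessarily in $\ell^2$), and let $X=(X_n)_{n\ge1}$ be a weak solution, with initial condition $x$, of the inviscid dyadic system $$\dot X_n = k_{n-1}X_{n-1}^2-k_nX_nX_{n+1},\qquad X_n(0)=x_n,\qquad n\ge1,\ t\ge0.$$ Suppose that one of the following hypotheses holds: 1. $x\in \ell^\infty$; there is an increasing sequence of indices $(n_i)_{i\ge1}$ such that $x_{n_i}\ge0$ for all $i\ge1$; and for some $\delta\in(0,1)$, some $j_0\in\mathbb{N}$ and all $j\ge j_0$, $n_{j+1}\le k_{n_j}^{\frac23\delta}$. 2. $x\in H$ and $X$ is a Leray-Hopf solution. Then there exists $\tau>0$ such that $X(t)\in H^+$ for all $t\ge\tau$.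
   Context: Conventions: $k_n=2^{\beta n}$ for $n\ge1$, $k_0=0$ and $X_0\equiv0$. $H=\ell^2(\mathbb{R})$ is the Hilbert space of square-summable real sequences indexed by $n\ge1$, with usual norm $\|\cdot\|$, and $H^+=\{x\in H: x_i>0\text{ for all }i\ge1\}$. A weak solution is a sequence $X=(X_n)_{n\ge1}$ of real-valued differentiable functions on $[0,\infty)$ satisfying the system (equations and initial conditions) for all $n\ge1$ and $t\ge0$. A finite energy solution is a weak solution with $X(t)\in H$ for all $t\ge0$. A Leray-Hopf solution is a finite energy solution such that $\|X(t)\|$ is a non-increasing function of $t$. *)

(* Defs.v *)
(* Stdlib reals with Coquelicot series.

   Sequences indexed by n >= 1 are functions on [nat]; for a plain real sequence
   the entry at index 0 is never used. *)
From Stdlib Require Import Reals.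
From Coquelicot Require Import Coquelicot.

Local Open Scope R_scope.

Definition k (beta : R) (n : nat) : R :=
  match n with
  | O => 0
  | S _ => Rpower 2 (beta * INR n)
  end.

Definition in_linfty (x : nat -> R) : Prop :=
  exists M : R, forall n : nat, (1 <= n)%nat -> Rabs (x n) <= M.

(* The summation index is shifted so that sums run over n >= 1. *)
Definition in_H (x : nat -> R) : Prop :=
  ex_series (fun n : nat => (x (S n)) ^ 2).

(* Meaningful only when [in_H x] holds. *)
Definition norm_H (x : nat -> R) : R :=
  sqrt (Series (fun n : nat => (x (S n)) ^ 2)).

Definition in_Hplus (x : nat -> R) : Prop :=
  in_H x /\ forall i : nat, (1 <= i)%nat -> 0 < x i.

(* [D_in f d D t]: f has derivative d t at t relative to the domain D. On
   D = [0, +oo) this is the two-sided derivative for t > 0 and the right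
   derivative at t = 0; values of the X n at negative times play no role. *)
Definition weak_solution (beta : R) (x : nat -> R) (X : nat -> R -> R) : Prop :=
  (forall t : R, 0 <= t -> X 0%nat t = 0) /\
  (forall n : nat, (1 <= n)%nat -> X n 0 = x n) /\
  (forall n : nat, (1 <= n)%nat -> forall t : R, 0 <= t ->
     D_in (X n)
       (fun s : R => k beta (n - 1) * (X (n - 1)%nat s) ^ 2
                     - k beta n * X n s * X (n + 1)%nat s)
       (fun s : R => 0 <= s) t).

Definition finite_energy_solution
    (beta : R) (x : nat -> R) (X : nat -> R -> R) : Prop :=
  weak_solution beta x X /\
  forall t : R, 0 <= t -> in_H (fun n : nat => X n t).

Definition Leray_Hopf_solution
    (beta : R) (x : nat -> R) (X : nat -> R -> R) : Prop :=
  finite_energy_solution beta x X /\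
  forall s t : R, 0 <= s -> s <= t ->
    norm_H (fun n : nat => X n t) <= norm_H (fun n : nat => X n s).

(* Main.v *)
Require Import Defs.
From Stdlib Require Import Reals Lra Lia.
From Coquelicot Require Import Coquelicot.

Local Open Scope R_scope.

(** Let E_m = X_1^2 + ... + X_m^2. The equations telescope to
    E_m' = - 2 k_m X_m^2 X_{m+1}, so the sign of X_{m+1} alone decides whether
    energy leaves the first m modes or enters them. Moreover
    (w X_n)' = w k_{n-1} X_{n-1}^2 >= 0 for w = exp (int_0^t k_n X_{n+1}), so a
    mode that is positive (or nonnegative) stays so.

    Both hypotheses yield a bound E_m(t) <= B^2 r^{2m} for all m and t with
    r = 2^{beta delta / 3} and delta < 1. For a Leray-Hopf solution,
    E_m(t) <= ||X(t)||^2 <= ||x||^2. In the other case, with n_j <= m < n_{j+1},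
    the mode n_{j+1} stays nonnegative, so
    E_m(t) <= E_{n_{j+1} - 1}(0) <= M^2 n_{j+1} <= M^2 k_{n_j}^{2 delta / 3}.

    The main estimate (transit_time_bound) says that X_m^2 >= eta can hold only for
    a short time while X_{m+1} keeps a constant sign. Mode m pushes X_{m+1} up at
    rate k_m X_m^2 >= k_m eta. The only term that can resist,
    k_{m+1} X_{m+1} X_{m+2}, is controlled by |X_{m+1}|, that is, by the energy
    exchanged with mode m + 1, whose total is bounded because E_m is monotone.
    With the growth bound and eta = e rho^m, the length of that time is of order
    r^{3m} / (2^{beta m} rho^{2m}). As r^3 < 2^beta, rho can be chosen by
    r^3 = 2^beta rho^4, and the bound becomes D rho^{2m}, which is summable.

    Energy then cascades (modes_pos_and_energy_bounded): there are times s_m,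
    increasing to a finite limit, such that X_{m+1} > 0 and
    E_m <= (x_1^2 / 2) (1 - rho^m) after s_m. For the step from m to m + 1,
    suppose that X_{m+2} <= 0 at a later time. Then X_{m+2} <= 0 at all earlier
    times, E_{m+1} is still at least E_{m+1}(0) >= x_1^2, and X_{m+1}^2 must be
    large, which cannot last. So X_{m+2} becomes positive, E_{m+1} decreases, and
    by the same estimate it cannot stay above its threshold for long. After the
    limit of the s_m every mode is positive and every E_m is at most x_1^2 / 2;
    this also puts X(t) in H when x itself is not. *)

(** * The flow and its energies *)

(** Continuity is required on the whole line and the equation only at positive
    times, so that integrals and mean values need no one-sided notions.
    The coefficient q^n differs from k_n at n = 0, where it multiplies
    Z_0^2 = 0. *)
Definition dyadic_flow (q : R) (Z : nat -> R -> R) : Prop :=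
  (forall t, Z 0%nat t = 0) /\
  (forall n t, continuous (Z n) t) /\
  (forall n t, 0 < t ->
     is_derive (Z (S n)) t
       (q ^ n * Z n t ^ 2 - q ^ S n * Z (S n) t * Z (S (S n)) t)).

(** The sum may start at mode 0 because that mode vanishes identically. *)
Definition energy (Z : nat -> R -> R) (m : nat) (t : R) : R :=
  sum_f_R0 (fun i => Z i t ^ 2) m.

Definition energy_growth (B r : R) (Z : nat -> R -> R) : Prop :=
  forall m t, 0 <= t -> energy Z m t <= B ^ 2 * (r ^ m) ^ 2.

Lemma increment_ge_of_derive_ge (f d : R -> R) (c a b : R) :
  0 <= a <= b ->
  (forall t, continuous f t) ->
  (forall t, 0 < t -> is_derive f t (d t)) ->
  (forall t, a <= t <= b -> c <= d t) ->
  c * (b - a) <= f b - f a.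
Proof.
  intros Hab Hc Hd Hle.
  destruct (MVT_gen f a b d) as [u [Hu He]].
  - intros t Ht. rewrite Rmin_left in Ht by lra. apply Hd. lra.
  - intros t _. apply continuity_pt_filterlim. apply Hc.
  - rewrite Rmin_left, Rmax_right in Hu by lra.
    rewrite He. apply Rmult_le_compat_r; [lra | apply Hle; lra].
Qed.

Lemma energy_S (Z : nat -> R -> R) m t :
  energy Z (S m) t = energy Z m t + Z (S m) t ^ 2.
Proof. reflexivity. Qed.

Lemma energy_nonneg Z m t : 0 <= energy Z m t.
Proof. apply cond_pos_sum. intros i. apply pow2_ge_0. Qed.

Lemma energy_mono Z m n t : (m <= n)%nat -> energy Z m t <= energy Z n t.
Proof.
  induction 1 as [|n _ IH]; [lra|].
  rewrite energy_S. pose proof (pow2_ge_0 (Z (S n) t)). lra.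
Qed.

Lemma energy_continuous q Z m t : dyadic_flow q Z -> continuous (energy Z m) t.
Proof.
  intros [_ [Hc _]].
  induction m as [|m IH].
  - apply (continuous_comp (Z 0%nat) (fun y => y ^ 2)); [apply Hc|].
    apply continuity_pt_filterlim, derivable_continuous_pt, derivable_pt_pow.
  - apply (continuous_plus (energy Z m) (fun s => Z (S m) s ^ 2)); [exact IH|].
    apply (continuous_comp (Z (S m)) (fun y => y ^ 2)); [apply Hc|].
    apply continuity_pt_filterlim, derivable_continuous_pt, derivable_pt_pow.
Qed.

(** The flux k_m X_m^2 X_{m+1} out of mode m is the flux into mode m + 1, so the
    sum telescopes and only the last flux remains. *)
Lemma energy_derive q Z m t :
  dyadic_flow q Z -> 0 < t ->
  is_derive (energy Z m) t (- 2 * q ^ m * Z m t ^ 2 * Z (S m) t).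
Proof.
  intros [H0 [_ Hd]] Ht.
  induction m as [|m IH].
  - apply (is_derive_ext (fun _ => 0)).
    + intros s. unfold energy. simpl. rewrite H0. ring.
    + rewrite H0. replace (_ * _) with 0 by ring. apply @is_derive_const.
  - apply (is_derive_ext (fun s => energy Z m s + Z (S m) s ^ 2)).
    + reflexivity.
    + pose proof (is_derive_pow _ 2 _ _ (Hd m t Ht)) as Hp.
      pose proof (is_derive_plus _ _ _ _ _ IH Hp) as Hs.
      eapply is_derive_ext; [|eapply eq_ind; [exact Hs|]].
      * reflexivity.
      * unfold plus; simpl. ring.
Qed.

(** * Persistence of signs *)

(** With the integrating factor w = exp (int_0^t q^{n+1} Z_{n+2}), the equation for
    mode n + 1 becomes (w Z_{n+1})' = w q^n Z_n^2 >= 0. *)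
Lemma weighted_mode_nondecreasing q Z n :
  0 < q -> dyadic_flow q Z ->
  exists w : R -> R,
    (forall t, 0 < w t) /\
    forall a b, 0 <= a <= b -> w a * Z (S n) a <= w b * Z (S n) b.
Proof.
  intros Hq [_ [Hc Hd]].
  set (g := fun t => q ^ S n * Z (S (S n)) t).
  assert (Hg : forall t, continuous g t).
  { intros t. apply (continuous_scal_r (q ^ S n) (Z (S (S n)))). apply Hc. }
  assert (HG : forall t, is_derive (fun s => RInt g 0 s) t (g t)).
  { intros t. apply (is_derive_RInt _ _ 0); [|apply Hg].
    apply filter_forall. intros s. apply @RInt_correct.
    apply @ex_RInt_continuous. intros; apply Hg. }
  assert (HE : forall t, is_derive (fun s => exp (RInt g 0 s)) t
                           (g t * exp (RInt g 0 t))).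
  { intros t. apply (is_derive_comp exp (fun s => RInt g 0 s));
      [apply is_derive_exp | apply HG]. }
  exists (fun t => exp (RInt g 0 t)).
  split; [intros; apply exp_pos|].
  intros a b Hab.
  enough (0 * (b - a) <= exp (RInt g 0 b) * Z (S n) b - exp (RInt g 0 a) * Z (S n) a)
    by lra.
  apply (increment_ge_of_derive_ge (fun t => exp (RInt g 0 t) * Z (S n) t)
           (fun t => exp (RInt g 0 t) * (q ^ n * Z n t ^ 2))).
  - exact Hab.
  - intros t. apply (continuous_mult (fun s => exp (RInt g 0 s)) (Z (S n))); [|apply Hc].
    apply (ex_derive_continuous (fun s => exp (RInt g 0 s))). eexists. apply HE.
  - intros t Ht.
    pose proof (is_derive_mult (fun s => exp (RInt g 0 s)) (Z (S n)) t _ _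
                  (HE t) (Hd n t Ht) Rmult_comm) as Hm.
    eapply eq_ind; [exact Hm|].
    unfold plus, mult, g; simpl. ring.
  - intros t _. apply Rmult_le_pos; [left; apply exp_pos|].
    apply Rmult_le_pos; [apply pow_le; lra | apply pow2_ge_0].
Qed.

Lemma mode_pos_persists q Z n a b :
  0 < q -> dyadic_flow q Z -> 0 <= a <= b -> 0 < Z (S n) a -> 0 < Z (S n) b.
Proof.
  intros Hq HZ Hab Ha.
  destruct (weighted_mode_nondecreasing q Z n Hq HZ) as [w [Hw Hm]].
  specialize (Hm a b Hab).
  pose proof (Rmult_lt_0_compat _ _ (Hw a) Ha).
  apply (Rmult_lt_reg_l (w b)); [apply Hw | lra].
Qed.

Lemma mode_nonneg_persists q Z n a b :
  0 < q -> dyadic_flow q Z -> 0 <= a <= b -> 0 <= Z (S n) a -> 0 <= Z (S n) b.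
Proof.
  intros Hq HZ Hab Ha.
  destruct (weighted_mode_nondecreasing q Z n Hq HZ) as [w [Hw Hm]].
  specialize (Hm a b Hab).
  pose proof (Rmult_le_pos _ _ (Rlt_le _ _ (Hw a)) Ha).
  apply (Rmult_le_reg_l (w b)); [apply Hw | lra].
Qed.

Lemma energy_nonincreasing q Z m a b :
  0 < q -> dyadic_flow q Z -> 0 <= a <= b ->
  (forall t, a <= t <= b -> 0 <= Z (S m) t) ->
  energy Z m b <= energy Z m a.
Proof.
  intros Hq HZ Hab Hs.
  enough (0 * (b - a) <= - energy Z m b - - energy Z m a) by lra.
  apply (increment_ge_of_derive_ge (fun t => - energy Z m t)
           (fun t => - (- 2 * q ^ m * Z m t ^ 2 * Z (S m) t))); [exact Hab | | |].
  - intros t. apply (continuous_opp (energy Z m)). now apply (energy_continuous q).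
  - intros t Ht. apply (is_derive_opp (energy Z m)). now apply energy_derive.
  - intros t Ht. pose proof (Hs t Ht).
    assert (0 <= q ^ m * Z m t ^ 2 * Z (S m) t); [|lra].
    apply Rmult_le_pos; [|assumption].
    apply Rmult_le_pos; [apply pow_le; lra | apply pow2_ge_0].
Qed.

Lemma energy_nondecreasing q Z m a b :
  0 < q -> dyadic_flow q Z -> 0 <= a <= b ->
  (forall t, a <= t <= b -> Z (S m) t <= 0) ->
  energy Z m a <= energy Z m b.
Proof.
  intros Hq HZ Hab Hs.
  enough (0 * (b - a) <= energy Z m b - energy Z m a) by lra.
  apply (increment_ge_of_derive_ge (energy Z m)
           (fun t => - 2 * q ^ m * Z m t ^ 2 * Z (S m) t)); [exact Hab | | |].
  - intros t. now apply (energy_continuous q).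
  - intros t Ht. now apply energy_derive.
  - intros t Ht. pose proof (Hs t Ht).
    assert (0 <= q ^ m * Z m t ^ 2 * - Z (S m) t); [|lra].
    apply Rmult_le_pos; [|lra].
    apply Rmult_le_pos; [apply pow_le; lra | apply pow2_ge_0].
Qed.

(** * How long a mode can stay large *)

(** Let s be the sign of Z_{m+1}, so that s Z_{m+1} = |Z_{m+1}|, and
    F = Z_{m+1} - s A E_m. The energy term contributes
    2 A q^m Z_m^2 |Z_{m+1}| >= 2 A q^m eta |Z_{m+1}| to F', and A is chosen so that
    this cancels the worst case q^{m+1} |Z_{m+1}| C2 of the loss term. Hence
    F' >= q^m eta, whereas F varies by at most 2 C1 + A W. *)
Lemma transit_time_bound q Z m a b eta C1 C2 W :
  0 < q -> dyadic_flow q Z -> 0 <= a <= b -> 0 < eta ->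
  (forall t, a <= t <= b -> eta <= Z m t ^ 2) ->
  (forall t, a <= t <= b -> Rabs (Z (S m) t) <= C1) ->
  (forall t, a <= t <= b -> Rabs (Z (S (S m)) t) <= C2) ->
  (forall t, a <= t <= b -> energy Z m t <= W) ->
  (forall t, a <= t <= b -> 0 <= Z (S m) t) \/
  (forall t, a <= t <= b -> Z (S m) t <= 0) ->
  q ^ m * eta * (b - a) <= 2 * C1 + q * C2 / (2 * eta) * W.
Proof.
  intros Hq HZ Hab Heta Hm H1 H2 HW Hsign.
  set (A := q * C2 / (2 * eta)).
  assert (Hqm : 0 < q ^ m) by now apply pow_lt.
  assert (HC2 : 0 <= C2).
  { pose proof (H2 a ltac:(lra)). pose proof (Rabs_pos (Z (S (S m)) a)). lra. }
  assert (HA : 0 <= A).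
  { apply Rmult_le_pos; [nra|]. left. apply Rinv_0_lt_compat. lra. }
  assert (Hsg : exists s : R, (s = 1 \/ s = -1) /\
            forall t, a <= t <= b -> s * Z (S m) t = Rabs (Z (S m) t)).
  { destruct Hsign as [Hs | Hs]; [exists 1 | exists (-1)]; split; auto;
      intros t Ht; pose proof (Hs t Ht);
      [rewrite Rabs_pos_eq | rewrite Rabs_left1]; lra. }
  destruct Hsg as [s [Hs Habs]].
  assert (Hmain : q ^ m * eta * (b - a) <=
            (Z (S m) b - s * A * energy Z m b) - (Z (S m) a - s * A * energy Z m a)).
  { apply (increment_ge_of_derive_ge (fun t => Z (S m) t - s * A * energy Z m t)
      (fun t => (q ^ m * Z m t ^ 2 - q ^ S m * Z (S m) t * Z (S (S m)) t)
                - s * A * (- 2 * q ^ m * Z m t ^ 2 * Z (S m) t))); [exact Hab | | |].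
    - intros t. apply (continuous_minus (Z (S m)) (fun t => s * A * energy Z m t)).
      + apply HZ.
      + apply (continuous_scal_r (s * A) (energy Z m)). now apply (energy_continuous q).
    - intros t Ht. apply (is_derive_minus (Z (S m)) (fun t => s * A * energy Z m t)).
      + now apply HZ.
      + apply (is_derive_scal (energy Z m) t (s * A)). now apply energy_derive.
    - intros t Ht.
      specialize (Hm t Ht). specialize (H2 t Ht). specialize (Habs t Ht).
      set (y := Rabs (Z (S m) t)) in *.
      assert (Hy : 0 <= y) by apply Rabs_pos.
      assert (Hprod : Z (S m) t * Z (S (S m)) t <= y * C2).
      { eapply Rle_trans; [apply Rle_abs|]. rewrite Rabs_mult.
        apply Rmult_le_compat_l; assumption. }
      assert (HAe : 2 * A * eta = q * C2) by (unfold A; field; lra).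
      replace (_ - _) with
        (q ^ m * (Z m t ^ 2 - q * (Z (S m) t * Z (S (S m)) t)
                  + 2 * A * Z m t ^ 2 * (s * Z (S m) t))) by (simpl; ring).
      rewrite Habs. apply Rmult_le_compat_l; [lra|].
      assert (q * (Z (S m) t * Z (S (S m)) t) <= q * (y * C2))
        by (apply Rmult_le_compat_l; lra).
      assert (2 * A * eta * y <= 2 * A * Z m t ^ 2 * y)
        by (apply Rmult_le_compat_r; [|apply Rmult_le_compat_l]; lra).
      rewrite HAe in *. lra. }
  pose proof (H1 a ltac:(lra)) as Ha1. pose proof (H1 b ltac:(lra)) as Hb1.
  apply Rabs_le_between in Ha1. apply Rabs_le_between in Hb1.
  pose proof (HW a ltac:(lra)). pose proof (HW b ltac:(lra)).
  pose proof (energy_nonneg Z m a). pose proof (energy_nonneg Z m b).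
  assert (s * A * (energy Z m a - energy Z m b) <= A * W).
  { destruct Hs as [-> | ->]; nra. }
  lra.
Qed.

Lemma mode_le_of_energy_growth B r Z m t :
  0 <= B -> 0 <= r -> energy_growth B r Z -> 0 <= t -> Rabs (Z m t) <= B * r ^ m.
Proof.
  intros HB Hr HE Ht.
  apply Rsqr_incr_0_var.
  - rewrite <- Rsqr_abs. rewrite !Rsqr_pow2, Rpow_mult_distr.
    eapply Rle_trans; [|apply HE; exact Ht].
    destruct m as [|m]; [apply Rle_refl|].
    rewrite energy_S. pose proof (energy_nonneg Z m t). lra.
  - apply Rmult_le_pos; [exact HB | now apply pow_le].
Qed.

(** The bound of transit_time_bound for mode m + 1 with eta = e rho^m. After
    multiplication by eta both of its terms are O(r^{3(m+1)}), which the relation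
    between r, q and rho turns into O(q^{m+1} rho^{4m}); dividing by
    q^{m+1} eta^2 leaves O(rho^{2m}). *)
Lemma transit_time_geometric q r rho B e Z :
  0 < q -> 1 <= r -> 0 < rho < 1 -> r ^ 3 = q * rho ^ 4 -> 0 < B -> 0 < e ->
  dyadic_flow q Z -> energy_growth B r Z ->
  exists D, 0 < D /\ forall m a b, 0 <= a <= b ->
    (forall t, a <= t <= b -> e * rho ^ m <= Z (S m) t ^ 2) ->
    (forall t, a <= t <= b -> 0 <= Z (S (S m)) t) \/
    (forall t, a <= t <= b -> Z (S (S m)) t <= 0) ->
    b - a < D * (rho ^ m) ^ 2.
Proof.
  intros Hq Hr Hrho Hscale HB He HZ HE.
  set (K := (2 * B * r * e + q * B ^ 3 * r ^ 2 / 2) / e ^ 2).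
  assert (HK : 0 < K).
  { apply Rdiv_lt_0_compat; [|now apply pow_lt].
    assert (0 < B * r * e) by (repeat apply Rmult_lt_0_compat; lra).
    assert (0 < q * B ^ 3 * r ^ 2)
      by (repeat apply Rmult_lt_0_compat; try apply pow_lt; lra).
    lra. }
  exists (K + 1). split; [lra|].
  intros m a b Hab Hm Hsign.
  set (p := rho ^ m).
  set (g := r ^ S m).
  assert (Hp : 0 < p <= 1).
  { split; [apply pow_lt; lra|]. unfold p. rewrite <- (pow1 m). apply pow_incr; lra. }
  assert (Hg : 1 <= g) by now apply pow_R1_Rle.
  assert (Heta : 0 < e * p) by nra.
  assert (Hg3 : g ^ 3 = q ^ S m * (rho * p) ^ 4).
  { unfold g, p. rewrite (tech_pow_Rmult rho m).
    rewrite <- !pow_mult, (Nat.mul_comm _ 3), (Nat.mul_comm _ 4), !pow_mult.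
    rewrite Hscale, Rpow_mult_distr. reflexivity. }
  assert (Hb := transit_time_bound q Z (S m) a b (e * p) (B * (r * g)) (B * (r ^ 2 * g))
                  (B ^ 2 * g ^ 2) Hq HZ Hab Heta Hm).
  assert (Hraw : q ^ S m * (e * p) * (b - a) <=
            2 * (B * (r * g)) + q * (B * (r ^ 2 * g)) / (2 * (e * p)) * (B ^ 2 * g ^ 2)).
  { apply Hb; [intros t Ht | intros t Ht | intros t Ht | exact Hsign].
    - eapply Rle_trans; [apply (mode_le_of_energy_growth B r); auto; lra|].
      unfold g; simpl; lra.
    - eapply Rle_trans; [apply (mode_le_of_energy_growth B r); auto; lra|].
      unfold g; simpl; lra.
    - apply HE; lra. }
  clear Hb.
  assert (Hqm : 0 < q ^ S m) by now apply pow_lt.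
  assert (HKe : K * e ^ 2 = 2 * B * r * e + q * B ^ 3 * r ^ 2 / 2)
    by (unfold K; field; lra).
  assert (Hmul : q ^ S m * e ^ 2 * p ^ 2 * (b - a) <= q ^ S m * e ^ 2 * p ^ 2 * (K * p ^ 2)).
  { apply Rmult_le_compat_l with (r := e * p) in Hraw; [|lra].
    replace (e * p * (q ^ S m * (e * p) * (b - a)))
      with (q ^ S m * e ^ 2 * p ^ 2 * (b - a)) in Hraw by ring.
    replace (e * p * _) with (2 * B * r * e * (p * g) + q * B ^ 3 * r ^ 2 / 2 * g ^ 3)
      in Hraw by (field; lra).
    eapply Rle_trans; [exact Hraw|].
    assert (Hpg : p * g <= g ^ 3).
    { assert (1 <= g ^ 2) by nra. assert (g <= g ^ 3) by (simpl in *; nra). nra. }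
    assert (Hpos : 0 <= 2 * B * r * e)
      by (repeat apply Rmult_le_pos; lra).
    apply Rle_trans with ((K * e ^ 2) * g ^ 3).
    - rewrite HKe. rewrite (Rmult_plus_distr_r _ _ (g ^ 3)).
      apply Rplus_le_compat_r. now apply Rmult_le_compat_l.
    - rewrite Hg3, Rpow_mult_distr.
      assert (rho ^ 4 <= 1) by (rewrite <- (pow1 4); apply pow_incr; lra).
      replace (q ^ S m * e ^ 2 * p ^ 2 * (K * p ^ 2))
        with (K * e ^ 2 * (q ^ S m * (1 * p ^ 4))) by ring.
      repeat apply Rmult_le_compat_l.
      + left. apply Rmult_lt_0_compat; [exact HK | now apply pow_lt].
      + lra.
      + apply Rmult_le_compat_r; [apply pow_le; lra | assumption]. }
  apply Rmult_le_reg_l in Hmul.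
  - pose proof (pow_lt p 2 ltac:(lra)). lra.
  - repeat apply Rmult_lt_0_compat; try apply pow_lt; lra.
Qed.

(** * The cascade *)

(** The energy thresholds are c (1 - rho^m) with c = Z_1(0)^2 / 2: their gaps
    c (1 - rho) rho^m are the levels eta of transit_time_geometric, and they stay
    below c, leaving room under the initial energy 2 c. The times
    T (1 - rho^{2m}) are the partial sums of two delays D rho^{2m} per mode. *)
Lemma modes_pos_and_energy_bounded q r rho B Z :
  0 < q -> 1 <= r -> 0 < rho < 1 -> r ^ 3 = q * rho ^ 4 -> 0 < B ->
  dyadic_flow q Z -> energy_growth B r Z -> 0 < Z 1%nat 0 ->
  exists tau, 0 < tau /\ forall m t, tau <= t ->
    0 < Z (S m) t /\ energy Z m t <= Z 1%nat 0 ^ 2 / 2.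
Proof.
  intros Hq Hr Hrho Hscale HB HZ HE Hz1.
  set (c := Z 1%nat 0 ^ 2 / 2).
  assert (Hc : 0 < c) by (unfold c; nra).
  assert (He : 0 < c * (1 - rho)) by nra.
  destruct (transit_time_geometric q r rho B (c * (1 - rho)) Z) as [D [HD Htransit]]; auto.
  set (T := 2 * D / (1 - rho ^ 2)).
  assert (Hrho2 : 0 < 1 - rho ^ 2) by nra.
  assert (HT : 0 < T) by (apply Rdiv_lt_0_compat; lra).
  assert (HTD : T * (1 - rho ^ 2) = 2 * D) by (unfold T; field; lra).
  assert (Hrange : forall m, 0 < rho ^ m <= 1).
  { intros m. split; [apply pow_lt; lra|]. rewrite <- (pow1 m). apply pow_incr; lra. }
  assert (Hcascade : forall m t, T * (1 - (rho ^ m) ^ 2) <= t ->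
            0 < Z (S m) t /\ energy Z m t <= c * (1 - rho ^ m)).
  { induction m as [|m IH]; intros t Ht.
    - simpl in Ht. split.
      + apply (mode_pos_persists q Z 0 0 t); auto. lra.
      + unfold energy. simpl. rewrite (proj1 HZ). lra.
    - pose proof (Hrange m) as Hp.
      set (s := T * (1 - (rho ^ m) ^ 2)) in *.
      set (d := D * (rho ^ m) ^ 2) in *.
      assert (Hd : 0 < d) by (apply Rmult_lt_0_compat; [|apply pow_lt]; lra).
      assert (Hs : 0 <= s) by (apply Rmult_le_pos; nra).
      assert (Hstep : T * (1 - (rho ^ S m) ^ 2) = s + 2 * d).
      { replace (s + 2 * d) with (s + (2 * D) * (rho ^ m) ^ 2) by (unfold d; ring).
        rewrite <- HTD. unfold s. simpl. ring. }
      rewrite Hstep in Ht.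
      (* From time s on, energy above the next threshold must sit in mode S m. *)
      assert (Hdom : forall u, s <= u ->
                c * (1 - rho ^ S m) <= energy Z (S m) u ->
                c * (1 - rho) * rho ^ m <= Z (S m) u ^ 2).
      { intros u Hu Hen. destruct (IH u Hu) as [_ Hlow].
        rewrite energy_S in Hen. simpl in *. lra. }
      (* If mode S (S m) is nonpositive at u, it was so during all of [0, u], so no
         energy has ever left the first S m modes: they hold at least x_1^2 = 2 c. *)
      assert (Hpos : forall u, s + d <= u -> 0 < Z (S (S m)) u).
      { intros u Hu. apply Rnot_le_lt. intros Hneg.
        assert (Hpast : forall v, 0 <= v <= u -> Z (S (S m)) v <= 0).
        { intros v Hv. apply Rnot_lt_le. intros Hvp.
          pose proof (mode_pos_persists q Z (S m) v u Hq HZ ltac:(lra) Hvp). lra. }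
        assert (Hwait : u - s < d); [|lra].
        apply Htransit; [lra | | right; intros v Hv; apply Hpast; lra].
        intros v Hv. apply Hdom; [lra|].
        apply Rle_trans with (2 * c).
        { pose proof (Hrange (S m)). apply Rle_trans with (c * 1); [|lra].
          apply Rmult_le_compat_l; lra. }
        apply Rle_trans with (energy Z (S m) 0).
        - apply Rle_trans with (energy Z 1 0); [|apply energy_mono; lia].
          rewrite energy_S. pose proof (energy_nonneg Z 0 0). unfold c. lra.
        - apply (energy_nondecreasing q); auto; [lra|]. intros w Hw. apply Hpast; lra. }
      split; [apply Hpos; lra|].
      (* Once mode S (S m) is positive, energy leaves the first S m modes; a second
         delay d is enough to bring it below the threshold. *)
      apply Rnot_lt_le. intros Hlarge.
      assert (Hwait : t - (s + d) < d); [|lra].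
      assert (Hnn : forall v, s + d <= v <= t -> 0 <= Z (S (S m)) v)
        by (intros v Hv; left; apply Hpos; lra).
      apply Htransit; [lra | | left; exact Hnn].
      intros v Hv. apply Hdom; [lra|].
      apply Rle_trans with (energy Z (S m) t); [lra|].
      apply (energy_nonincreasing q); auto; [lra|]. intros w Hw. apply Hnn; lra. }
  exists T. split; [exact HT|].
  intros m t Ht. pose proof (Hrange m).
  destruct (Hcascade m t) as [Hpos Hen]; [nra|].
  split; [exact Hpos | nra].
Qed.

(** * Weak solutions as flows *)

Lemma Rmax_0_dist s t : Rdist (Rmax 0 s) (Rmax 0 t) <= Rdist s t.
Proof.
  unfold Rdist, Rmax. destruct (Rle_dec 0 s), (Rle_dec 0 t);
    unfold Rabs; repeat destruct Rcase_abs; lra.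
Qed.

(** Freezing a function at its value at 0 for negative times makes one-sided
    continuity at 0 two-sided. *)
Lemma continuous_comp_Rmax_0 (f d : R -> R) :
  (forall t, 0 <= t -> D_in f d (fun s => 0 <= s) t) ->
  forall t, continuous (fun s => f (Rmax 0 s)) t.
Proof.
  intros Hd t.
  apply continuity_pt_filterlim.
  intros eps Heps.
  destruct (cont_deriv _ _ _ _ (Hd (Rmax 0 t) (Rmax_l 0 t)) eps Heps) as [al [Hal Hlim]].
  exists al. split; [exact Hal|].
  intros s [_ Hs]. simpl in *.
  destruct (Req_dec (Rmax 0 t) (Rmax 0 s)) as [->|Hne].
  - rewrite Rdist_eq. lra.
  - apply Hlim. split; [split; [apply Rmax_l | exact Hne]|].
    eapply Rle_lt_trans; [apply Rmax_0_dist | exact Hs].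
Qed.

Lemma is_derive_comp_Rmax_0 (f d : R -> R) t :
  0 < t -> D_in f d (fun s => 0 <= s) t ->
  is_derive (fun s => f (Rmax 0 s)) t (d t).
Proof.
  intros Ht HD.
  apply (is_derive_ext_loc f).
  { exists (mkposreal t Ht). intros s Hs.
    apply Rabs_def2 in Hs. unfold minus, plus, opp in Hs; simpl in Hs.
    rewrite Rmax_right by lra. reflexivity. }
  apply is_derive_Reals.
  intros eps Heps.
  destruct (HD eps Heps) as [al [Hal Hlim]].
  assert (Hmin : 0 < Rmin al t) by now apply Rmin_pos.
  exists (mkposreal _ Hmin). intros h Hh Hht. simpl in Hht.
  pose proof (Rmin_l al t). pose proof (Rmin_r al t).
  specialize (Hlim (t + h)). simpl in Hlim. unfold Rdist in Hlim.
  replace (t + h - t) with h in Hlim by ring.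
  apply Hlim. split; [split; [|lra]|lra].
  apply Rabs_def2 in Hht. lra.
Qed.

Definition half_line_extension (X : nat -> R -> R) (n : nat) (t : R) : R :=
  X n (Rmax 0 t).

Lemma half_line_extension_nonneg X n t :
  0 <= t -> half_line_extension X n t = X n t.
Proof. intros Ht. unfold half_line_extension. now rewrite Rmax_right. Qed.

Lemma k_S beta n : k beta (S n) = Rpower 2 beta ^ S n.
Proof.
  unfold k. rewrite <- Rpower_pow by apply exp_pos.
  now rewrite Rpower_mult.
Qed.

Lemma dyadic_flow_of_weak_solution beta x X :
  weak_solution beta x X -> dyadic_flow (Rpower 2 beta) (half_line_extension X).
Proof.
  intros [H0 [_ Hd]].
  split; [|split].
  - intros t. apply H0, Rmax_l.
  - intros [|n] t.
    + apply (continuous_ext (fun _ => 0)); [|apply continuous_const].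
      intros s. symmetry. apply H0, Rmax_l.
    + eapply continuous_comp_Rmax_0. apply (Hd (S n)). lia.
  - intros n t Ht.
    pose proof (is_derive_comp_Rmax_0 _ _ t Ht (Hd (S n) ltac:(lia) t ltac:(lra))) as HD.
    eapply eq_ind; [exact HD|].
    rewrite !half_line_extension_nonneg by lra.
    rewrite k_S. replace (S n - 1)%nat with n by lia.
    replace (S n + 1)%nat with (S (S n)) by lia.
    destruct n as [|n]; [rewrite H0 by lra; simpl; ring | now rewrite k_S].
Qed.

Lemma Rpower_2_ge_1 c : 0 <= c -> 1 <= Rpower 2 c.
Proof.
  intros Hc. rewrite <- (Rpower_O 2) at 1 by lra. apply Rle_Rpower; lra.
Qed.

(** * Energy growth under the two hypotheses *)

Lemma energy_0_le beta x X M m :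
  weak_solution beta x X -> (forall n, (1 <= n)%nat -> Rabs (x n) <= M) ->
  energy (half_line_extension X) m 0 <= M ^ 2 * INR m.
Proof.
  intros [H0 [Hx _]] HM.
  induction m as [|m IH].
  - unfold energy. simpl. rewrite half_line_extension_nonneg, H0 by lra. lra.
  - rewrite energy_S, S_INR, half_line_extension_nonneg, Hx by (lra || lia).
    assert (x (S m) ^ 2 <= M ^ 2); [|lra].
    rewrite <- pow2_abs. apply pow_incr. split; [apply Rabs_pos | apply HM; lia].
Qed.

Lemma bracket_increasing (u : nat -> nat) J m :
  (forall j, (J <= j)%nat -> (u j < u (S j))%nat) -> (u J <= m)%nat ->
  exists j, (J <= j)%nat /\ (u j <= m < u (S j))%nat.
Proof.
  intros Hu. induction m as [|m IH]; intros Hm.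
  - exists J. specialize (Hu J). lia.
  - destruct (Nat.le_gt_cases (u J) m) as [Hle|Hgt].
    + destruct (IH Hle) as [j [Hj Hb]].
      destruct (Nat.le_gt_cases (u (S j)) (S m)).
      * exists (S j). specialize (Hu (S j)). lia.
      * exists j. lia.
    + exists J. specialize (Hu J). lia.
Qed.

(** A nonnegative mode ni j only takes energy from the modes below it, so their
    energy never exceeds its initial value, which is at most M^2 ni j. A general m
    is compared with the next index ni (S j) above it, and the gap condition makes
    ni (S j) at most r^(2 ni j) <= r^(2 m). The finitely many m below ni J are
    absorbed in the constant. *)
Lemma energy_growth_of_sparse_nonneg beta x X (ni : nat -> nat) J r M :
  weak_solution beta x X ->
  (forall n, (1 <= n)%nat -> Rabs (x n) <= M) ->
  (forall j, (J <= j)%nat -> (1 <= ni j < ni (S j))%nat) ->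
  (forall j, (J <= j)%nat -> 0 <= x (ni j)) ->
  1 <= r ->
  (forall j, (J <= j)%nat -> INR (ni (S j)) <= (r ^ ni j) ^ 2) ->
  exists B, 0 < B /\ energy_growth B r (half_line_extension X).
Proof.
  intros HX HM Hni Hnn Hr Hgap.
  pose proof (dyadic_flow_of_weak_solution _ _ _ HX) as HZ.
  set (Z := half_line_extension X) in *.
  assert (Hq : 0 < Rpower 2 beta) by apply exp_pos.
  assert (HEn : forall j m t, (J <= j)%nat -> (m < ni j)%nat -> 0 <= t ->
            energy Z m t <= M ^ 2 * INR (ni j)).
  { intros j m t Hj Hm Ht.
    pose proof (Hni j Hj) as Hnij.
    destruct (ni j) as [|p] eqn:Ep; [lia|].
    apply Rle_trans with (energy Z p t); [apply energy_mono; lia|].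
    apply Rle_trans with (energy Z p 0).
    - apply (energy_nonincreasing (Rpower 2 beta)); auto; [lra|].
      intros u Hu. apply (mode_nonneg_persists (Rpower 2 beta) Z p 0 u); auto; [lra|].
      unfold Z. rewrite half_line_extension_nonneg by lra.
      rewrite (proj1 (proj2 HX)) by lia. rewrite <- Ep. now apply Hnn.
    - eapply Rle_trans; [exact (energy_0_le beta x X M p HX HM)|].
      apply Rmult_le_compat_l; [apply pow2_ge_0 | apply le_INR; lia]. }
  assert (HMpos : 0 <= M).
  { eapply Rle_trans; [apply Rabs_pos | apply (HM 1%nat); lia]. }
  assert (HJ1 : 1 <= INR (ni J)) by (apply (le_INR 1); apply Hni; lia).
  exists ((M + 1) * INR (ni J)). split; [nra|].
  intros m t Ht.
  assert (Hrm : forall n, 1 <= r ^ n) by (intros n; now apply pow_R1_Rle).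
  assert (HB : M ^ 2 * INR (ni J) <= ((M + 1) * INR (ni J)) ^ 2).
  { replace (((M + 1) * INR (ni J)) ^ 2)
      with ((M + 1) ^ 2 * (INR (ni J) * INR (ni J))) by ring.
    apply Rmult_le_compat; [apply pow2_ge_0 | lra | apply pow_incr; lra | nra]. }
  destruct (Nat.le_gt_cases (ni J) m) as [Hle|Hgt].
  - destruct (bracket_increasing ni J m) as [j [Hj Hb]]; [apply Hni | exact Hle |].
    eapply Rle_trans; [apply (HEn (S j)); auto; lia|].
    apply Rmult_le_compat; [apply pow2_ge_0 | apply pos_INR | apply pow_incr; nra |].
    eapply Rle_trans; [now apply Hgap|].
    apply pow_incr. split; [specialize (Hrm (ni j)); lra|].
    apply Rle_pow; [exact Hr | lia].
  - eapply Rle_trans; [now apply (HEn J)|].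
    eapply Rle_trans; [exact HB|].
    rewrite <- (Rmult_1_r (_ ^ 2)) at 1.
    apply Rmult_le_compat_l; [apply pow2_ge_0 | now apply pow_R1_Rle].
Qed.

Lemma energy_eq_sum_n Z m t :
  Z 0%nat t = 0 -> energy Z (S m) t = sum_n (fun n => Z (S n) t ^ 2) m.
Proof.
  intros H0. induction m as [|m IH].
  - rewrite sum_O. unfold energy. simpl. rewrite H0. ring.
  - rewrite sum_Sn, <- IH. reflexivity.
Qed.

Lemma energy_le_norm_H X m t :
  0 <= t -> X 0%nat t = 0 -> in_H (fun n => X n t) ->
  energy (half_line_extension X) m t <= norm_H (fun n => X n t) ^ 2.
Proof.
  intros Ht H0 HH.
  set (a := fun n => X (S n) t ^ 2).
  assert (Hsum : forall n, sum_n a n <= Series a).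
  { intros n. apply (is_lim_seq_incr_compare (sum_n a)).
    - apply (Series_correct a HH).
    - intros i. rewrite sum_Sn. unfold plus, a; simpl.
      pose proof (pow2_ge_0 (X (S (S i)) t)) as Hsq. simpl in Hsq. lra. }
  assert (HE : energy (half_line_extension X) m t <= Series a).
  { eapply Rle_trans; [apply (energy_mono _ m (S m)); lia|].
    rewrite energy_eq_sum_n by now rewrite half_line_extension_nonneg.
    eapply Rle_trans; [|apply (Hsum m)]. apply Req_le, sum_n_ext.
    intros n. unfold a. now rewrite half_line_extension_nonneg. }
  unfold norm_H. rewrite pow2_sqrt; [exact HE|].
  eapply Rle_trans; [apply energy_nonneg | exact HE].
Qed.

Lemma energy_growth_of_Leray_Hopf beta x X r :
  Leray_Hopf_solution beta x X -> 1 <= r ->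
  exists B, 0 < B /\ energy_growth B r (half_line_extension X).
Proof.
  intros [[[H0 _] HH] Hnorm] Hr.
  set (N := fun t => norm_H (fun n => X n t)) in *.
  assert (HN : forall t, 0 <= N t) by (intros; apply sqrt_pos).
  exists (N 0 + 1). split; [specialize (HN 0); lra|].
  intros m t Ht.
  apply Rle_trans with (N t ^ 2); [apply energy_le_norm_H; auto|].
  apply Rle_trans with ((N 0 + 1) ^ 2 * 1).
  - rewrite Rmult_1_r. apply pow_incr.
    pose proof (HN t). pose proof (Hnorm 0 t ltac:(lra) Ht) as Hle.
    fold (N 0) (N t) in Hle. lra.
  - apply Rmult_le_compat_l; [apply pow2_ge_0|].
    now apply pow_R1_Rle, pow_R1_Rle.
Qed.

Lemma in_H_of_energy_le X t C :
  0 <= t -> X 0%nat t = 0 ->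
  (forall m, energy (half_line_extension X) m t <= C) -> in_H (fun n => X n t).
Proof.
  intros Ht H0 HC.
  destruct (ex_finite_lim_seq_incr (sum_n (fun n => X (S n) t ^ 2)) C) as [l Hl].
  - intros n. rewrite sum_Sn.
    pose proof (pow2_ge_0 (X (S (S n)) t)). unfold plus; simpl in *. lra.
  - intros n. eapply Rle_trans; [|apply (HC (S n))].
    rewrite energy_eq_sum_n by now rewrite half_line_extension_nonneg.
    apply Req_le, sum_n_ext. intros i. now rewrite half_line_extension_nonneg.
  - exists l. exact Hl.
Qed.

(** * Conclusion *)

(** This is where delta < 1 enters: rho = 2^(- beta (1 - delta) / 4) solves
    r^3 = 2^beta rho^4 for r = 2^(beta delta / 3), and it lies below 1. *)
Lemma eventually_positive_of_energy_growth beta delta x X B :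
  0 < beta -> 0 < delta < 1 -> weak_solution beta x X -> 0 < x 1%nat -> 0 < B ->
  energy_growth B (Rpower 2 (beta * delta / 3)) (half_line_extension X) ->
  exists tau, 0 < tau /\ forall t, tau <= t -> in_Hplus (fun n => X n t).
Proof.
  intros Hbeta Hdelta HX Hx1 HB HE.
  set (rho := Rpower 2 (- (beta * (1 - delta) / 4))).
  assert (Hrho : 0 < rho < 1).
  { split; [apply exp_pos|]. rewrite <- (Rpower_O 2) by lra.
    apply Rpower_lt; [lra|]. nra. }
  destruct (modes_pos_and_energy_bounded (Rpower 2 beta) (Rpower 2 (beta * delta / 3))
              rho B (half_line_extension X)) as [tau [Htau Hlate]]; auto.
  - apply exp_pos.
  - apply Rpower_2_ge_1. nra.
  - unfold rho. rewrite <- !Rpower_pow by apply exp_pos.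
    rewrite !Rpower_mult, <- Rpower_plus. f_equal. simpl. field.
  - now apply dyadic_flow_of_weak_solution with x.
  - rewrite half_line_extension_nonneg by lra. rewrite (proj1 (proj2 HX)) by lia. exact Hx1.
  - exists tau. split; [exact Htau|]. intros t Ht. split.
    + eapply in_H_of_energy_le; [lra | apply HX; lra |].
      intros m. apply (Hlate m t Ht).
    + intros [|i] Hi; [lia|]. rewrite <- half_line_extension_nonneg by lra.
      apply (Hlate i t Ht).
Qed.

Theorem theorem7 (beta : R) (x : nat -> R) (X : nat -> R -> R)
  (hbeta : 0 < beta)
  (hx1 : 0 < x 1%nat)
  (hX : weak_solution beta x X)
  (hyp :
    (in_linfty x /\
     exists ni : nat -> nat,
       (forall i : nat, (1 <= i)%nat -> (1 <= ni i)%nat) /\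
       (forall i : nat, (1 <= i)%nat -> (ni i < ni (i + 1))%nat) /\
       (forall i : nat, (1 <= i)%nat -> 0 <= x (ni i)) /\
       exists (delta : R) (j0 : nat),
         0 < delta < 1 /\
         forall j : nat, (1 <= j)%nat -> (j0 <= j)%nat ->
           INR (ni (j + 1)%nat) <= Rpower (k beta (ni j)) (2 / 3 * delta))
    \/
    (in_H x /\ Leray_Hopf_solution beta x X)) :
  exists tau : R, 0 < tau /\
    forall t : R, tau <= t -> in_Hplus (fun n : nat => X n t).
Proof.
  destruct hyp as [[[M HM] [ni [Hge1 [Hincr [Hnn [delta [j0 [Hdelta Hgap]]]]]]]] | [_ HLH]].
  - set (r := Rpower 2 (beta * delta / 3)).
    destruct (energy_growth_of_sparse_nonneg beta x X ni (S j0) r M) as [B [HB HE]]; auto.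
    + intros j Hj. specialize (Hge1 j ltac:(lia)). specialize (Hincr j ltac:(lia)).
      rewrite Nat.add_1_r in Hincr. lia.
    + intros j Hj. apply Hnn. lia.
    + unfold r. apply Rpower_2_ge_1. nra.
    + intros j Hj. specialize (Hgap j ltac:(lia) ltac:(lia)).
      rewrite Nat.add_1_r in Hgap.
      eapply Rle_trans; [exact Hgap|]. apply Req_le.
      pose proof (Hge1 j ltac:(lia)).
      (* Here r^2 = (2^beta)^(2 delta / 3), so (r^n)^2 = k_n^(2 delta / 3). *)
      destruct (ni j) as [|p]; [lia|].
      unfold k, r. rewrite <- pow_mult, <- Rpower_pow by apply exp_pos.
      rewrite !Rpower_mult, mult_INR. f_equal. change (INR 2) with 2. field.
    + apply (eventually_positive_of_energy_growth beta delta x X B); auto.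
  (* The energy is bounded uniformly, so any exponent delta in (0, 1) will do. *)
  - destruct (energy_growth_of_Leray_Hopf beta x X (Rpower 2 (beta * (1 / 2) / 3)) HLH)
      as [B [HB HE]].
    + apply Rpower_2_ge_1. lra.
    + apply (eventually_positive_of_energy_growth beta (1 / 2) x X B); auto. lra.
Qed.
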